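(* Let $f$ be a strongly biased random multiplicative function such that, for some fixed $0<\alpha\le 1/2$, almost surely the series $\sum_{p\in\mathcal{P}}\frac{1+f(p)}{p^{1-\alpha+\epsilon}}$ converges for every $\epsilon>0$. Then: almost surely $M_f(x)=o(x^{1-\alpha+\epsilon})$ for all $\epsilon>0$, if and only if $M_\mu(x)=o(x^{1-\alpha+\epsilon})$ for all $\epsilon>0$.
   Context: $\mathcal{P}$ denotes the set of primes and $\mu$ the Möbius function. A random multiplicative function is a random function $f:\mathbb{N}\times\Omega\to\{-1,0,1\}$ with $f(1)=1$, $f(n)=|\mu(n)|\prod_{p\mid n}f(p)$ for $n\ge2$, where $\{f(p)\}_{p\in\mathcal{P}}$ are independent $\pm1$-valued random variables. $f$ is biased if $\mathbb{E} f(p)<0$ for all primes $p$; it is strongly biased if it is biased and $\sum_{p\in\mathcal{P}} f(p)/p=-\infty$ almost surely. $M_f(x):=\sum_{n\le x}f(n)$, $M_\mu(x):=\sum_{n\le x}\mu(n)$. *)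

(* Defs.v *)
From HB Require Import structures.
From mathcomp Require Import all_boot all_order all_algebra.
From mathcomp Require Import all_classical all_reals all_analysis.

Set Implicit Arguments.
Unset Strict Implicit.
Unset Printing Implicit Defensive.

Import Order.TTheory GRing.Theory Num.Theory.
Import numFieldNormedType.Exports.

Local Open Scope classical_set_scope.
Local Open Scope ring_scope.

(* Lets the library's Landau notation be used with the filter at [+oo]. *)
Canonical pinfty_filter_on (R : numFieldType) :=
  FilterType (pinfty_nbhs R) _.

Definition squarefree (n : nat) : bool :=
  (0 < n)%N && all (fun p => ~~ (p ^ 2 %| n)%N) (primes n).

Definition mobius (n : nat) : int :=
  if squarefree n then (-1) ^+ size (primes n) else 0.

(* [Num.truncn x] is the floor of [x] for [x >= 0], and [0] for [x < 0] (empty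
   sum). *)
Definition summatory (R : realType) (a : nat -> R) (x : R) : R :=
  \sum_(1 <= n < (Num.truncn x).+1) a n.

(* Primes are taken in increasing order. *)
Definition prime_series (R : realType) (a : nat -> R) : R^nat :=
  fun N => \sum_(0 <= p < N | prime p) a p.

Section RandomMultiplicative.
Context (d : measure_display) (T : measurableType d) (R : realType).
Variable P : probability T R.

(* Mutual independence of the subfamily [X_i], [i \in I]: the product rule for
   every finite subfamily. *)
Definition mutually_independent (I : pred nat) (X : nat -> {RV P >-> R}) : Prop :=
  forall (s : seq nat) (B : nat -> set R),
    uniq s -> all I s -> (forall i, measurable (B i)) ->
    P [set w | forall i, i \in s -> B i (X i w)] =
    (\prod_(i <- s) P (X i @^-1` B i))%E.

(* The value [f 0] is unconstrained, the domain being the positive integers. *)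
Definition random_multiplicative (f : nat -> {RV P >-> R}) : Prop :=
  [/\ forall n w, (0 < n)%N -> f n w \in [:: -1; 0; 1],
      forall p w, prime p -> f p w = 1 \/ f p w = -1,
      mutually_independent prime f,
      forall w, f 1%N w = 1
    & forall n w, (2 <= n)%N ->
        f n w = `|(mobius n)%:~R| * \prod_(p <- primes n) f p w].

Definition biased (f : nat -> {RV P >-> R}) : Prop :=
  forall p, prime p -> ('E_P[f p] < 0)%E.

Definition strongly_biased (f : nat -> {RV P >-> R}) : Prop :=
  biased f /\
  {ae P, forall w, prime_series (fun p => f p w / p%:R) @ \oo --> -oo_R}.

End RandomMultiplicative.

(* Main.v *)
Require Import Defs.
From HB Require Import structures.
From mathcomp Require Import all_boot all_order all_algebra.
From mathcomp Require Import all_classical all_reals all_analysis.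
From mathcomp Require Import ring lra.

Set Implicit Arguments.
Unset Strict Implicit.
Unset Printing Implicit Defensive.

Import Order.TTheory GRing.Theory Num.Theory.
Import numFieldNormedType.Exports.

Local Open Scope classical_set_scope.
Local Open Scope ring_scope.

(** Changing the value of a multiplicative function at one prime [q] from [1] to
    [-1], or back, costs little. If [M' N] is the sum over [n <= N] prime to [q],
    then [M N = M' N + s q * M' (N / q)]. Solving for [M'], a bound
    [|M N| <= C N^sigma] gives [|M' N| <= C / (1 - x) N^sigma] with
    [x = q^(-sigma)], so after the change the bound holds with the constant
    [C (1 + x) / (1 - x)]. For each outcome, [f] and [mu] differ at the primes
    with [f p = 1] only; as the sum of [p^(-sigma)] over them converges for
    [sigma > 1 - alpha], the product of these factors is finite, and bounds pass
    in both directions. *)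

(** Common form of the two functions to compare: on positive integers it is the Möbius function for
    [s] constantly -1, and one outcome of [f] for [s p = f p w]. Only the values at primes
    matter. *)
Definition sqfree_ext (R : realType) (s : nat -> R) (n : nat) : R :=
  if squarefree n then \prod_(p <- primes n) s p else 0.

Definition partial_sum (R : realType) (s : nat -> R) (N : nat) : R :=
  \sum_(1 <= n < N.+1) sqfree_ext s n.

Definition coprime_sum (R : realType) (q : nat) (s : nat -> R) (N : nat) : R :=
  \sum_(1 <= n < N.+1 | ~~ (q %| n)%N) sqfree_ext s n.

(** * Splitting a partial sum at one prime *)

Lemma perm_primesM (q m : nat) : prime q -> (0 < m)%N -> ~~ (q %| m)%N ->
  perm_eq (primes (q * m)) (q :: primes m).
Proof.
move=> hq hm hqm; apply: uniq_perm.
- exact: primes_uniq.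
- by rewrite /= primes_uniq andbT mem_primes hq hm.
- move=> p; rewrite (primesM _ (prime_gt0 hq) hm) in_cons; congr (_ || _).
  by rewrite primes_prime// inE.
Qed.

Lemma squarefreeM (q m : nat) : prime q -> (0 < m)%N ->
  squarefree (q * m) = ~~ (q %| m)%N && squarefree m.
Proof.
move=> hq hm; have hqm0 : (0 < q * m)%N by rewrite muln_gt0 prime_gt0.
rewrite /squarefree hm hqm0 /=.
have [hqm|hqm] /= := boolP (q %| m)%N.
  apply/negbTE/allPn; exists q.
    by rewrite mem_primes hq hqm0 dvdn_mulr.
  by rewrite negbK expnS expn1 dvdn_pmul2l ?prime_gt0.
rewrite (perm_all _ (perm_primesM hq hm hqm)) /=.
rewrite expnS expn1 dvdn_pmul2l ?prime_gt0// hqm /=.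
apply: eq_in_all => p; rewrite mem_primes => /and3P[hp _ hpm].
rewrite Gauss_dvdr// coprimeXl// prime_coprime//.
by apply: contra hqm; rewrite dvdn_prime2// => /eqP <-.
Qed.

Lemma sqfree_extM (R : realType) (s : nat -> R) (q m : nat) :
  prime q -> (0 < m)%N ->
  sqfree_ext s (q * m) = if (q %| m)%N then 0 else s q * sqfree_ext s m.
Proof.
move=> hq hm; rewrite /sqfree_ext squarefreeM//.
have [//|hqm] /= := boolP (q %| m)%N.
have [_|_] := boolP (squarefree m); last by rewrite mulr0.
by rewrite (perm_big _ (perm_primesM hq hm hqm)) big_cons.
Qed.

(** Induction on [N]: the quotient [N %/ q] grows exactly when [N] reaches a multiple of [q], and
    that multiple is the new term. *)
Lemma sum_multiples (R : realType) (a : nat -> R) (q N : nat) : (0 < q)%N ->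
  \sum_(1 <= n < N.+1 | (q %| n)%N) a n =
  \sum_(1 <= m < (N %/ q).+1) a (q * m)%N.
Proof.
move=> hq; elim: N => [|N IH]; first by rewrite div0n !big_nil.
rewrite big_mkcond big_nat_recr//= -big_mkcond IH divnS//.
have [hd|_] := boolP (q %| N.+1)%N; last by rewrite addr0.
rewrite add1n [in RHS]big_nat_recr//=; congr (_ + a _).
by rewrite -{1}(divnK hd) divnS// hd add1n mulnC.
Qed.

(** Among the multiples [q * m], those with [q] dividing [m] have a square factor and vanish; the
    others carry the factor [s q]. *)
Lemma partial_sum_split (R : realType) (s : nat -> R) (q N : nat) : prime q ->
  partial_sum s N = coprime_sum q s N + s q * coprime_sum q s (N %/ q).
Proof.
move=> hq; rewrite /partial_sum (bigID (fun n => q %| n)%N) /= addrC.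
congr (_ + _); rewrite sum_multiples ?prime_gt0// /coprime_sum.
rewrite [X in _ = _ * X]big_mkcond /= mulr_sumr; apply: eq_big_nat => m /andP[hm _].
by rewrite sqfree_extM//; case: ifP => _ //=; rewrite mulr0.
Qed.

Lemma eq_coprime_sum (R : realType) (s t : nat -> R) (q N : nat) :
  (forall p, prime p -> p != q -> s p = t p) ->
  coprime_sum q s N = coprime_sum q t N.
Proof.
move=> hst; rewrite /coprime_sum big_nat_cond [RHS]big_nat_cond.
apply: eq_bigr => n /andP[_ hqn]; rewrite /sqfree_ext; case: ifP => // _.
apply: eq_big_seq => p; rewrite mem_primes => /and3P[hp _ hpn].
by apply: hst => //; apply: contra hqn => /eqP <-.
Qed.

Lemma eq_partial_sum (R : realType) (s t : nat -> R) (N : nat) :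
  (forall p, prime p -> (p <= N)%N -> s p = t p) ->
  partial_sum s N = partial_sum t N.
Proof.
move=> hst; apply: eq_big_nat => n /andP[hn0 hnN]; rewrite /sqfree_ext.
case: ifP => // _; apply: eq_big_seq => p; rewrite mem_primes => /and3P[hp _ hpn].
by apply: hst => //; rewrite (leq_trans (dvdn_leq hn0 hpn)).
Qed.

(** * The cost of changing values at primes *)

Section PrimeFlip.
Context (R : realType) (sigma : R) (hsigma : 0 < sigma).
Implicit Types (s t : nat -> R).

Local Notation bounded_by s C :=
  (forall N : nat, `|partial_sum s N| <= C * N%:R `^ sigma).

Lemma powR_divn_le (N q : nat) : (0 < q)%N ->
  (N %/ q)%:R `^ sigma <= N%:R `^ sigma / q%:R `^ sigma :> R.
Proof.
move=> hq; have hq0 : 0 < q%:R `^ sigma :> R by rewrite powR_gt0 // ltr0n.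
rewrite ler_pdivlMr// -powRM ?ler0n// -natrM.
by apply: ge0_ler_powR; rewrite ?nnegrE ?ler0n ?(ltW hsigma)// ler_nat leq_trunc_div.
Qed.

(** Comparison with the prime 2 makes the constant in the cost of a flip independent of [q]. *)
Lemma prime_powRV_lt1 (q : nat) : prime q ->
  (q%:R `^ sigma)^-1 <= (2 `^ sigma)^-1 < 1.
Proof.
move=> hq; apply/andP; split.
  rewrite lef_pV2 ?posrE ?powR_gt0 ?ltr0n ?prime_gt0//.
  by apply: ge0_ler_powR; rewrite ?nnegrE ?ler0n ?(ltW hsigma)// ler_nat prime_gt1.
rewrite invf_lt1 ?powR_gt0//.
have := @gt0_ltr_powR R sigma hsigma 1 2; rewrite powR1 !nnegrE.
by apply; rewrite ?ler01 ?ler0n ?ltr1n.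
Qed.

Lemma coprime_sum_bound s (q : nat) (C : R) : prime q ->
  `|s q| = 1 -> 0 <= C -> bounded_by s C ->
  forall N : nat, `|coprime_sum q s N| <=
    C / (1 - (q%:R `^ sigma)^-1) * N%:R `^ sigma.
Proof.
move=> hq hs hC hM; have /andP[hx1 hx2] := prime_powRV_lt1 hq.
set x := (q%:R `^ sigma)^-1 in hx1 *.
have x1 : 0 < 1 - x by lra.
set K := C / (1 - x).
have hK : 0 <= K by rewrite divr_ge0// ltW.
(* [K] is the fixed point that closes the strong induction: [C] accounts for the full sum at [N],
   and [K * x] for the coprime sum at [N %/ q]. *)
have KE : K = C + K * x by rewrite /K; field; lra.
elim/ltn_ind => -[_|N IH].
  by rewrite /coprime_sum big_nil normr0 mulr_ge0// powR_ge0.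
have hlt : (N.+1 %/ q < N.+1)%N by rewrite ltn_Pdiv// prime_gt1.
have -> : coprime_sum q s N.+1 =
    partial_sum s N.+1 - s q * coprime_sum q s (N.+1 %/ q).
  by rewrite (partial_sum_split s _ (q := q))// addrK.
rewrite (le_trans (ler_normB _ _))// KE mulrDl lerD// normrM hs mul1r.
rewrite (le_trans (IH _ hlt))// -mulrA ler_wpM2l// mulrC.
by rewrite powR_divn_le// prime_gt0.
Qed.

(** The factor (1 + x) / (1 - x) is weakened to an exponential, so that the costs of successive
    flips multiply to the exponential of a sum over primes. *)
Lemma flip_prime_bound s t (q : nat) (C : R) : prime q ->
  `|s q| = 1 -> `|t q| = 1 -> 0 <= C ->
  (forall p, prime p -> p != q -> s p = t p) -> bounded_by s C ->
  bounded_by t (C * expR (2 / (1 - (2 `^ sigma)^-1) / q%:R `^ sigma)).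
Proof.
move=> hq hs ht hC hst hM N; have /andP[hx1 hx2] := prime_powRV_lt1 hq.
have hc := coprime_sum_bound hq hs hC hM.
have hN := hc N; have hNq := hc (N %/ q)%N.
(* Coprime sums do not see the value at [q], so those of [t] are those of [s], already bounded. *)
rewrite (partial_sum_split t _ (q := q))// -!(eq_coprime_sum (s := s) (t := t))//.
have hdiv := powR_divn_le N (prime_gt0 hq).
set x := (q%:R `^ sigma)^-1 in hx1 hN hNq hdiv *.
set r := (2 `^ sigma)^-1 in hx1 hx2 *.
have x0 : 0 <= x by rewrite invr_ge0 powR_ge0.
have x1 : 0 < 1 - x by lra.
have r1 : 0 < 1 - r by lra.
set K := C / (1 - x) in hN hNq.
have hK : 0 <= K by rewrite divr_ge0// ltW.
rewrite (le_trans (ler_normD _ _))// normrM ht mul1r.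
apply: le_trans (lerD hN hNq) _.
have hy := powR_ge0 (N%:R : R) sigma.
set y := N%:R `^ sigma in hy hdiv *.
apply: (@le_trans _ _ (K * y + K * (y * x))); first by rewrite lerD2l ler_wpM2l.
have -> : K * y + K * (y * x) = C * ((1 + x) / (1 - x)) * y.
  by rewrite /K; field; lra.
rewrite ler_wpM2r// ler_wpM2l//.
apply: le_trans (expR_ge1Dx _).
(* (1 + x) / (1 - x) <= 1 + 2 x / (1 - r) because x <= r < 1 *)
have -> : (1 + x) / (1 - x) = 1 + 2 * x / (1 - x) by field; lra.
rewrite lerD2l mulrAC ler_wpM2r// ler_wpM2l//.
by rewrite lef_pV2 ?posrE// lerD2l lerN2.
Qed.

Lemma flip_primes_bound s t (C : R) :
  (forall p, prime p -> `|s p| = 1) -> (forall p, prime p -> `|t p| = 1) ->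
  0 <= C -> bounded_by s C ->
  cvgn (prime_series (fun p => (s p != t p)%:R / p%:R `^ sigma)) ->
  exists2 D, 0 <= D & bounded_by t D.
Proof.
move=> hs ht hC hM hcv; set a := fun p => _ in hcv.
have ha p : 0 <= a p by rewrite divr_ge0 ?ler0n ?powR_ge0.
set c := 2 / (1 - (2 `^ sigma)^-1).
have hc : 0 <= c.
  have /andP[_ h] := @prime_powRV_lt1 2 isT.
  by rewrite divr_ge0// subr_ge0 ltW.
(* Interpolation from [s] to [t]: passing from [u k] to [u k.+1] changes the value at [k] only. *)
pose u k := fun p : nat => if (p < k)%N then t p else s p.
have hu k p : prime p -> `|u k p| = 1.
  by move=> hp; rewrite /u; case: ifP => _; [exact: ht|exact: hs].
have hb k : bounded_by (u k) (C * expR (c * prime_series a k)).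
  elim: k => [N|k IH].
    rewrite /prime_series big_nil mulr0 expR0 mulr1.
    by rewrite (_ : u 0%N = s)//; apply: funext => p; rewrite /u ltn0.
  have hS : prime_series a k.+1 = prime_series a k + (if prime k then a k else 0).
    by rewrite /prime_series big_mkcond big_nat_recr//= -big_mkcond.
  have hdiff p : p != k -> u k p = u k.+1 p.
    by move=> hpk; rewrite /u ltnS [(p <= k)%N]leq_eqVlt (negbTE hpk).
  have [/andP[hk hst]|hn] := boolP (prime k && (s k != t k)).
    move=> N; rewrite hS hk mulrDr expRD mulrA /a hst mul1r.
    apply: (@flip_prime_bound (u k)) => //.
    - exact: hu.
    - exact: hu.
    - by rewrite mulr_ge0// expR_ge0.
    - by move=> p _; exact: hdiff.
  (* Here [k] is not prime or [s] and [t] agree at it, so no sum changes. *)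
  move=> N; rewrite (_ : partial_sum (u k.+1) N = partial_sum (u k) N).
    rewrite hS; case: ifP hn => /= [_ /negPn/eqP hst|_ _].
      by rewrite /a hst eqxx mul0r addr0 IH.
    by rewrite addr0 IH.
  apply: eq_partial_sum => p hp _; have [pk|/hdiff//] := eqVneq p k.
  move: hn; rewrite -pk hp /= negbK => /eqP hst.
  by rewrite /u ltnSn ltnn hst.
exists (C * expR (c * limn (prime_series a))).
  by rewrite mulr_ge0// expR_ge0.
(* The sum up to [N] reads only primes up to [N], where [u N.+1] is already [t]. Since the terms are
   nonnegative, the limit of the series bounds every cost uniformly in [N]. *)
move=> N; rewrite (eq_partial_sum (t := u N.+1)); last first.
  by move=> p _ hp; rewrite /u ltnS hp.
apply: le_trans (hb N.+1 N) _.
rewrite ler_wpM2r ?powR_ge0// ler_wpM2l// ler_expR ler_wpM2l//.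
apply: nondecreasing_cvgn_le => //.
apply/nondecreasing_seqP => n.
rewrite /prime_series [leRHS]big_mkcond big_nat_recr//= -big_mkcond lerDl.
by case: ifP.
Qed.

End PrimeFlip.

(** * Passing between little-o and explicit power bounds *)

Lemma bounded_of_littleo (R : realType) (s : nat -> R) (sigma : R) :
  0 < sigma ->
  summatory (sqfree_ext s) =o_ (+oo_R) (fun x : R => x `^ sigma) ->
  exists2 C, 0 <= C & forall N : nat, `|partial_sum s N| <= C * N%:R `^ sigma.
Proof.
move=> hsig /eqoP/(_ 1 ltr01)[A [_ hA]].
pose B := (Num.truncn `|A|).+1.
(* The 1 serves beyond [A]; the sum absorbs the finitely many smaller [N], as N^sigma >= 1 for
   positive [N]. *)
exists (1 + \sum_(0 <= i < B) `|partial_sum s i|).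
  by rewrite addr_ge0// sumr_ge0.
case=> [|N].
  by rewrite /partial_sum big_nil normr0 powR0 ?mulr0// gt_eqF.
have hN1 : 1 <= N.+1%:R `^ sigma :> R.
  have := @ge0_ler_powR R sigma (ltW hsig) 1 N.+1%:R.
  by rewrite powR1 !nnegrE; apply; rewrite ?ler01 ?ler0n ?ler1n.
have hsum : 0 <= \sum_(0 <= i < B) `|partial_sum s i| by rewrite sumr_ge0.
have [hNB|hBN] := ltnP N.+1 B.
  rewrite -[leLHS]mulr1 ler_pM//.
  rewrite (big_cat_nat (n := N.+1)) ?(ltnW hNB)//= (big_ltn hNB).
  do 2 (apply: ler_wpDl; first by rewrite ?sumr_ge0).
  by rewrite lerDl sumr_ge0.
have hAN : A < N.+1%:R.
  rewrite (le_lt_trans (ler_norm A))// (lt_le_trans (truncnS_gt _))//.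
  by rewrite ler_nat.
have := hA _ hAN; rewrite /summatory /= natrK mul1r (ger0_norm (powR_ge0 _ _)) => h.
by apply: le_trans h _; rewrite ler_peMl ?powR_ge0// lerDl.
Qed.

Lemma littleo_of_bounded (R : realType) (s : nat -> R) (sigma tau C : R) :
  0 < sigma -> sigma < tau -> 0 <= C ->
  (forall N : nat, `|partial_sum s N| <= C * N%:R `^ sigma) ->
  summatory (sqfree_ext s) =o_ (+oo_R) (fun x : R => x `^ tau).
Proof.
move=> hsig hst hC hM; apply/eqoP => e e0.
(* The second entry is where C x^sigma meets e x^tau; the first keeps [x] positive. *)
pose A := Num.max 1 ((C / e) `^ (tau - sigma)^-1).
exists A; split; first by rewrite num_real.
move=> x; rewrite /A gt_max => /andP[x1 hx].
have x0 : 0 < x by rewrite (lt_trans ltr01).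
rewrite [X in _ <= _ * X]ger0_norm ?powR_ge0//.
apply: le_trans (hM _) _.
apply: (@le_trans _ _ (C * x `^ sigma)).
  rewrite ler_wpM2l// ge0_ler_powR ?nnegrE ?ler0n ?(ltW hsig) ?(ltW x0)//.
  by rewrite truncn_le// ltW.
rewrite -(subrK sigma tau) powRD; last by rewrite (gt_eqF x0) implybT.
rewrite mulrA ler_wpM2r ?powR_ge0// mulrC -ler_pdivrMr//.
have ts : 0 < tau - sigma by rewrite subr_gt0.
rewrite -[leLHS]powRr1 ?divr_ge0 ?(ltW e0)// -(mulVf (lt0r_neq0 ts)) powRrM.
by rewrite ge0_ler_powR ?nnegrE ?powR_ge0// ltW.
Qed.

Lemma littleo_flip_primes (R : realType) (s t : nat -> R) (beta : R) :
  0 < beta ->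
  (forall p, prime p -> `|s p| = 1) -> (forall p, prime p -> `|t p| = 1) ->
  (forall eps : R, 0 < eps -> cvgn (prime_series
     (fun p => (s p != t p)%:R / p%:R `^ (beta + eps)))) ->
  (forall eps : R, 0 < eps -> summatory (sqfree_ext s) =o_ (+oo_R)
     (fun x : R => x `^ (beta + eps))) ->
  forall eps : R, 0 < eps -> summatory (sqfree_ext t) =o_ (+oo_R)
     (fun x : R => x `^ (beta + eps)).
Proof.
move=> hb hs ht hcv ho e e0.
(* One half of [e] is spent on the convergence and the power bound, the other on returning from the
   bound to little-o. *)
have e20 : 0 < e / 2 by rewrite divr_gt0.
have hsig : 0 < beta + e / 2 by rewrite addr_gt0.
have [C hC hM] := bounded_of_littleo hsig (ho _ e20).
have [D hD hN] := flip_primes_bound hsig hs ht hC hM (hcv _ e20).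
by apply: (littleo_of_bounded hsig _ hD hN); lra.
Qed.

(** * Transfer between outcomes of [f] and the Möbius function *)

Theorem theorem1p2 (d : measure_display) (T : measurableType d) (R : realType)
    (P : probability T R) (f : nat -> {RV P >-> R}) (alpha : R)
    (hf : random_multiplicative f) (hbias : strongly_biased f)
    (halpha0 : 0 < alpha) (halpha1 : alpha <= 1 / 2)
    (hconv : {ae P, forall w, forall eps : R, 0 < eps ->
       cvgn (prime_series
               (fun p => (1 + f p w) / p%:R `^ (1 - alpha + eps)))}) :
  {ae P, forall w, forall eps : R, 0 < eps ->
     summatory (fun n => f n w) =o_ (+oo_R) (fun x : R => x `^ (1 - alpha + eps))}
  <->
  (forall eps : R, 0 < eps ->
     summatory (fun n => (mobius n)%:~R) =o_ (+oo_R)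
       (fun x : R => x `^ (1 - alpha + eps))).
Proof.
case: hf => _ hpm _ hf1 hfn.
have hbeta : 0 < 1 - alpha by lra.
have hf w : summatory (fun n => f n w) = summatory (sqfree_ext (fun p => f p w)).
  apply: funext => x; apply: eq_big_nat => -[//|[|n]] _.
    by rewrite hf1 /sqfree_ext /= big_nil.
  rewrite hfn// /sqfree_ext /mobius.
  case: ifP => _; last by rewrite normr0 mul0r.
  by rewrite rmorphXn /= rmorphN1 normrX normrN1 expr1n mul1r.
have hmu : summatory (fun n => (mobius n)%:~R : R) =
    summatory (sqfree_ext (fun _ => -1)).
  apply: funext => x; apply: eq_big_nat => n _; rewrite /sqfree_ext /mobius.
  case: ifP => _ //; rewrite rmorphXn /= rmorphN1.
  by rewrite big_const_seq count_predT iter_mulr_1.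
have habs w p : prime p -> `|f p w| = 1.
  by case/(hpm _ w) => ->; rewrite ?normrN1 ?normr1.
have habs1 p : prime p -> `|(-1 : R)| = 1 by rewrite normrN1.
have hcv w : (forall eps : R, 0 < eps -> cvgn (prime_series
      (fun p => (1 + f p w) / p%:R `^ (1 - alpha + eps)))) ->
    forall eps : R, 0 < eps -> cvgn (prime_series
      (fun p => (f p w != -1)%:R / p%:R `^ (1 - alpha + eps))).
  (* [1 + f p w] is 2 where [f] differs from the Möbius function and 0 elsewhere. *)
  move=> h e e0; rewrite (_ : prime_series _ =
      2^-1 *: prime_series (fun p => (1 + f p w) / p%:R `^ (1 - alpha + e))).
    by apply: is_cvgZr; exact: h.
  apply: funext => N; rewrite /prime_series fctE scaler_sumr.
  apply: eq_bigr => p hp; have [->|->] := hpm p w hp.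
    rewrite (_ : (1 : R) != -1) /=; last by apply/eqP; lra.
    by rewrite /GRing.scale /= mulrA -[1 + 1]/2 mulVf.
  by rewrite eqxx subrr !mul0r scaler0.
rewrite hmu; split => [hae|ho].
(* The conclusion is deterministic, so one outcome in both almost sure events suffices; it exists
   because the whole space has positive probability. *)
- have hP : (0 < P setT)%E by rewrite probability_setT.
  have := ae_properfilter_algebraOfSetsType hP => PF.
  have [w [hw1 hw2]] := filter_ex (filterI hae hconv).
  rewrite hf in hw1.
  exact: (littleo_flip_primes hbeta (habs w) habs1 (hcv w hw2)).
- apply: filterS hconv => w /hcv hw; rewrite hf.
  apply: (littleo_flip_primes hbeta habs1 (habs w)) => // e e0.
  under eq_fun do rewrite eq_sym.
  exact: hw.
Qed.
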